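(* Let $$F:=\{x\in\mathbb{R}^n : \langle v_i,x\rangle\le b_i,\ i=1,2\},$$ with $v_1,v_2\in\mathbb{R}^n$ linearly independent unit vectors and $b_1,b_2\in\mathbb{R}$. Then there exist $S\subset T\subset\mathbb{R}^n$, with $|S|=2$ and $|T|=4$, such that $V_T(S)=F$.
   Context: For a finite nonempty set $T\subset\mathbb{R}^n$ and a nonempty proper subset $S\subset T$, the multipoint (higher order) Voronoi cell is $$V_T(S):=\left\{x\in\mathbb{R}^n : \max_{s\in S}\|x-s\|\le\min_{t\in T\setminus S}\|x-t\|\right\},$$ where $\|\cdot\|$ is the Euclidean norm. *)

(* Defs.v *)
From HB Require Import structures.
From mathcomp Require Import all_boot all_order all_algebra finmap.
From mathcomp Require Import classical_sets reals constructive_ereal.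

Set Implicit Arguments.
Unset Strict Implicit.
Unset Printing Implicit Defensive.

Import Order.TTheory GRing.Theory Num.Theory.

Local Open Scope classical_set_scope.
Local Open Scope ring_scope.

Definition dot (R : realType) (n : nat) (u v : 'rV[R]_n) : R :=
  (u *m v^T) 0 0.

(* The norm `|x| that MathComp-Analysis puts on 'rV[R]_n is the sup norm,
   hence a separate Euclidean norm. *)
Definition enorm (R : realType) (n : nat) (x : 'rV[R]_n) : R :=
  Num.sqrt (dot x x).

(* The maximum and the minimum are taken in \bar R, where maxe and mine have
   the neutral elements -oo and +oo; for S a nonempty proper subset of T both
   are finite and are the usual maximum and minimum of the distances. *)
Definition voronoi_cell (R : realType) (n : nat) (T S : {fset 'rV[R]_n}) :
    set 'rV[R]_n :=
  [set x | (\big[maxe/-oo]_(s <- S) (enorm (x - s))%:E <=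
            \big[mine/+oo]_(t <- (T `\` S)%fset) (enorm (x - t))%:E)%E].

(* Main.v *)
Require Import Defs.
From HB Require Import structures.
From mathcomp Require Import all_boot all_order all_algebra finmap.
From mathcomp Require Import classical_sets reals constructive_ereal.
From mathcomp Require Import ring lra.

Set Implicit Arguments.
Unset Strict Implicit.
Unset Printing Implicit Defensive.

Import Order.TTheory GRing.Theory Num.Theory.

Local Open Scope classical_set_scope.
Local Open Scope ring_scope.

(* Let p be a point with <v_i, p> = b_i, and take S = {p - v1, p - v2} and
   T = S ∪ {p + v1, p + v2}.  These four points lie on the unit sphere around
   p, so p - v_i is at least as close to x as p + v_j exactly when
   <v_i + v_j, x - p> <= 0.  For i = j this is the i-th inequality defining F,
   and for i <> j it is implied by the two of them. *)

Section Dot.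
Variables (R : realType) (n : nat).
Implicit Types (u v w p x : 'rV[R]_n) (a : R).

Lemma dotC u v : dot u v = dot v u.
Proof. by rewrite /dot -[in LHS](trmxK u) -trmx_mul mxE. Qed.

Lemma dotDl u v w : dot (u + v) w = dot u w + dot v w.
Proof. by rewrite /dot mulmxDl mxE. Qed.

Lemma dotZl a u v : dot (a *: u) v = a * dot u v.
Proof. by rewrite /dot -scalemxAl mxE. Qed.

Lemma dotNl u v : dot (- u) v = - dot u v.
Proof. by rewrite -scaleN1r dotZl mulN1r. Qed.

Lemma dotDr u v w : dot w (u + v) = dot w u + dot w v.
Proof. by rewrite dotC dotDl !(dotC w). Qed.

Lemma dotZr a u v : dot v (a *: u) = a * dot v u.
Proof. by rewrite dotC dotZl dotC. Qed.

Lemma dotNr u v : dot v (- u) = - dot v u.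
Proof. by rewrite dotC dotNl dotC. Qed.

Lemma dot_sum u v : dot u v = \sum_i u 0 i * v 0 i.
Proof. by rewrite /dot mxE; apply: eq_bigr => i _; rewrite mxE. Qed.

Lemma dot_ge0 u : 0 <= dot u u.
Proof. by rewrite dot_sum sumr_ge0// => i _; rewrite -expr2 sqr_ge0. Qed.

Lemma dot_eq0 u : dot u u = 0 -> u = 0.
Proof.
rewrite dot_sum => /eqP; rewrite psumr_eq0; last first.
  by move=> i _; rewrite -expr2 sqr_ge0.
move=> /allP u0; apply/rowP => i; rewrite mxE; apply/eqP.
by have := u0 i (mem_index_enum _); rewrite /= mulf_eq0 orbb.
Qed.

Lemma enorm_sqr u : enorm u ^+ 2 = dot u u.
Proof. exact: sqr_sqrtr (dot_ge0 u). Qed.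

(** Expanding the squared distances, their difference is twice [dot (v + w) (x - p)] plus
    [dot v v - dot w w], and the last two terms cancel because the norms agree. *)
Lemma enorm_le_halfspace p x v w : enorm v = enorm w ->
  (enorm (x - (p - v)) <= enorm (x - (p + w))) =
  (dot (v + w) x <= dot (v + w) p).
Proof.
move=> vw; have {}vw : dot v v = dot w w by rewrite -!enorm_sqr vw.
rewrite ler_sqrt ?dot_ge0//.
rewrite !(dotDl, dotDr, dotNl, dotNr) vw.
rewrite (dotC x p) (dotC x v) (dotC x w) (dotC p v) (dotC p w).
by apply/idP/idP; lra.
Qed.

(** This is the Gram determinant of [v] and [w]. It equals the squared norm of [v - dot v w *: w],
    so its vanishing would put [v] on the line of [w]. *)
Lemma unit_free_dot_neq v w : enorm v = 1 -> enorm w = 1 -> v \notin <[w]>%VS ->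
  1 - dot v w ^+ 2 != 0.
Proof.
move=> v1 w1 /vlineP vw; apply/eqP => g1; apply: vw; exists (dot v w).
apply/subr0_eq/dot_eq0.
rewrite !(dotDl, dotDr, dotNl, dotNr, dotZl, dotZr) -!enorm_sqr v1 w1 (dotC w v).
by rewrite -g1; ring.
Qed.

(** Provides a common point of the two bounding hyperplanes, the centre of the construction. *)
Lemma exists_dot_eq v w a b : enorm v = 1 -> enorm w = 1 ->
  v \notin <[w]>%VS -> exists p, dot v p = a /\ dot w p = b.
Proof.
move=> v1 w1 vw; have g0 := unit_free_dot_neq v1 w1 vw.
set g := dot v w in g0.
(* For a point in the span of [v] and [w], the coefficients solve a system with Gram matrix
   [[1, g; g, 1]]; these are the values given by Cramer's rule. *)
exists (((a - g * b) / (1 - g ^+ 2)) *: v + ((b - g * a) / (1 - g ^+ 2)) *: w).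
rewrite !(dotDr, dotZr) -!enorm_sqr v1 w1 (dotC w v) -/g.
by split; field.
Qed.

End Dot.

Lemma bigmaxe_le (R : realType) (I : eqType) (r : seq I) (F : I -> \bar R) m :
  (\big[maxe/-oo]_(i <- r) F i <= m)%E = all (fun i => F i <= m)%E r.
Proof. by elim: r => [|i r IH]; rewrite ?big_nil ?leNye// big_cons ge_max IH. Qed.

Lemma bigmine_ge (R : realType) (I : eqType) (r : seq I) (F : I -> \bar R) m :
  (m <= \big[mine/+oo]_(i <- r) F i)%E = all (fun i => m <= F i)%E r.
Proof. by elim: r => [|i r IH]; rewrite ?big_nil ?leey// big_cons le_min IH. Qed.

(** Trades the extremum over each set for pairwise comparisons; the neutral elements [-oo] and [+oo]
    make this valid for empty sets too. *)
Lemma voronoi_cellP (R : realType) (n : nat) (T S : {fset 'rV[R]_n}) x :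
  voronoi_cell T S x <->
  {in S & (T `\` S)%fset, forall s t, enorm (x - s) <= enorm (x - t)}.
Proof.
rewrite /voronoi_cell /= bigmaxe_le; split=> [/allP h s t sS tT|h].
  by have := h s sS; rewrite bigmine_ge => /allP/(_ t tT); rewrite lee_fin.
apply/allP => s sS; rewrite bigmine_ge; apply/allP => t tT.
by rewrite lee_fin h.
Qed.

Theorem proposition3p8 (R : realType) (n : nat) (v1 v2 : 'rV[R]_n) (b1 b2 : R)
    (hfree : free [:: v1; v2]) (hv1 : enorm v1 = 1) (hv2 : enorm v2 = 1) :
  exists S T : {fset 'rV[R]_n},
    [/\ (S `<=` T)%fset, #|` S| = 2%N, #|` T| = 4%N &
        voronoi_cell T S = [set x | dot v1 x <= b1 /\ dot v2 x <= b2]].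
Proof.
have v12 : v1 \notin <[v2]>%VS.
  by move: hfree; rewrite free_cons span_seq1 => /andP[].
have [p [pb1 pb2]] := exists_dot_eq b1 b2 hv1 hv2 v12.
have neq12 : v1 != v2 by apply: contra v12 => /eqP->; exact: memv_line.
have neqN12 : v1 != - v2.
  by apply: contra v12 => /eqP->; rewrite memvN memv_line.
have neqN (u : 'rV[R]_n) : enorm u = 1 -> u != - u.
  move=> u1; apply/eqP => uN; have := enorm_sqr u.
  have := dotNl u u; rewrite -uN -enorm_sqr u1; lra.
pose S : {fset 'rV[R]_n} := [fset (p - v1)%R; (p - v2)%R]%fset.
pose S' : {fset 'rV[R]_n} := [fset (p + v1)%R; (p + v2)%R]%fset.
(* A common point would mean that some [v_i] is [- v_j]: for i = j this contradicts the unit norm,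
   for i <> j independence. Disjointness yields both the cardinality 4 and the complement of [S]. *)
have dis : [disjoint S & S']%fset.
  apply/fdisjointP => s; rewrite !inE => /orP[]/eqP->.
    rewrite !(inj_eq (addrI p)) negb_or !(eq_sym (- v1)) neqN//=.
    by rewrite -eqr_oppLR eq_sym.
  by rewrite !(inj_eq (addrI p)) negb_or !(eq_sym (- v2)) neqN// neqN12.
exists S, (S `|` S')%fset; split.
- exact: fsubsetUl.
- by rewrite cardfs2 (inj_eq (addrI p)) eqr_opp neq12.
- rewrite cardfsU (eqP dis) cardfs0 !cardfs2 !(inj_eq (addrI p)) eqr_opp.
  by rewrite neq12.
- have TS : ((S `|` S') `\` S = S')%fset.
    by rewrite fsetDUl fsetDv fset0U; apply/fsetDidPl; rewrite fdisjoint_sym.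
  apply/seteqP; split=> x /=; rewrite voronoi_cellP TS.
    move=> h.
    have S1 : p - v1 \in S by rewrite !inE eqxx.
    have S2 : p - v2 \in S by rewrite !inE eqxx orbT.
    have T1 : p + v1 \in S' by rewrite !inE eqxx.
    have T2 : p + v2 \in S' by rewrite !inE eqxx orbT.
    (* Comparing only opposite points [p - v_i] and [p + v_i] gives each inequality of the target,
       doubled. *)
    have := h _ _ S1 T1; have := h _ _ S2 T2.
    by rewrite !enorm_le_halfspace// !dotDl pb1 pb2; lra.
  move=> [x1 x2] s t; rewrite !inE => /orP[]/eqP-> /orP[]/eqP->;
    by rewrite enorm_le_halfspace ?hv1 ?hv2// !dotDl ?pb1 ?pb2; lra.
Qed.
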